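(* Let $n\ge1$ and let $\mathcal{N}\in A_n$ be a topdrop-valid necklace in $S_n$. Then the number of distinct orbits of the topdrop map in $S_n$ whose topdrop-necklace is $\mathcal{N}$ equals $$\frac{\bigl(n-d(\mathcal{N})\bigr)!}{P(\mathcal{N})},$$ where $d(\mathcal{N})$ is the number of distinct values appearing in $\mathcal{N}$.
   Context: Permutations are in one-line notation $\pi=\pi_1\cdots\pi_n$. The topdrop map $T:S_n\to S_n$ is $T(\pi_1\cdots\pi_n)=\pi_{\pi_1+1}\cdots\pi_n\,\pi_{\pi_1}\pi_{\pi_1-1}\cdots\pi_1$ (first $\pi_1$ entries removed, reversed, appended at the end); it is a bijection. The orbit of $\pi$ is $(\pi,T(\pi),\dots,T^{s-1}(\pi))$ with $s\ge1$ minimal such that $T^s(\pi)=\pi$. The topdrop-necklace of $\pi$ (and of its orbit) is the cyclic sequence $[\pi_1,T(\pi)_1,\dots,T^{s-1}(\pi)_1]$, considered up to cyclic rotation; its size is $s$. A necklace is topdrop-valid in $S_n$ if it is the topdrop-necklace of some $\pi\in S_n$; $A_n$ is the set of such necklaces. For a necklace $\mathcal{N}=[x_1,\dots,x_s]$, let $t$ be the length of the shortest contiguous segment which, repeated, forms $\mathcal{N}$ (i.e. the least $t\ge1$ with $x_{i+t}=x_i$ for all $i$, indices mod $s$); the fundamental period is $P(\mathcal{N})=s/t$, the number of copies of that segment needed. *)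

(* Defs.v *)
From mathcomp Require Import all_boot fingroup perm.

Set Implicit Arguments.
Unset Strict Implicit.
Unset Printing Implicit Defensive.

(** [S_n] is mathcomp's ['S_n], whose elements act on ['I_n = {0, .., n-1}];
    the entry [v : 'I_n] of the one-line notation stands for the value [v.+1],
    so that entries range over [1, .., n]. *)

Definition oneline (n : nat) (p : 'S_n) : seq 'I_n := [seq p i | i : 'I_n].

(* The default value [0] is only reached when [n = 0]. *)
Definition top (n : nat) (p : 'S_n) : nat :=
  head 0 [seq (val v).+1 | v <- oneline p].

Definition topdrop_line (n : nat) (p : 'S_n) : seq 'I_n :=
  drop (top p) (oneline p) ++ rev (take (top p) (oneline p)).

Lemma perm_topdrop_line (n : nat) (p : 'S_n) :
  perm_eq (topdrop_line p) (oneline p).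
Proof.
rewrite /topdrop_line -[X in perm_eq _ X](cat_take_drop (top p)).
by rewrite perm_catC perm_cat2r perm_rev.
Qed.

Lemma size_topdrop_line (n : nat) (p : 'S_n) : size (topdrop_line p) = n.
Proof. by rewrite (perm_size (perm_topdrop_line p)) size_map size_enum_ord. Qed.

Lemma topdrop_subproof (n : nat) (p : 'S_n) :
  injective (fun i : 'I_n => nth i (topdrop_line p) i).
Proof.
move=> i j; rewrite (set_nth_default i j) ?size_topdrop_line //.
move/eqP; rewrite nth_uniq ?size_topdrop_line // => [/eqP/val_inj //|].
by rewrite (perm_uniq (perm_topdrop_line p)) map_inj_uniq ?enum_uniq //;
  exact: perm_inj.
Qed.

Definition topdrop (n : nat) (p : 'S_n) : 'S_n := perm (@topdrop_subproof n p).

Lemma size_oneline (n : nat) (p : 'S_n) : size (oneline p) = n.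
Proof. by rewrite size_map size_enum_ord. Qed.

Lemma oneline_topdrop (n : nat) (p : 'S_n) :
  oneline (topdrop p) = topdrop_line p.
Proof.
have [n0|[x0]] : n = 0 \/ exists x0 : 'I_n, true.
- by case: n p => [|n] _; [left | right; exists ord0].
- have /size0nil -> : size (oneline (topdrop p)) = 0 by rewrite size_oneline.
  by have /size0nil -> : size (topdrop_line p) = 0 by rewrite size_topdrop_line.
move=> _; apply: (@eq_from_nth _ x0) => [|i].
  by rewrite size_topdrop_line size_oneline.
rewrite size_oneline => lt_in.
rewrite (nth_map x0) ?size_enum_ord // permE nth_enum_ord //.
by apply: set_nth_default; rewrite size_topdrop_line.
Qed.

Lemma oneline_inj (n : nat) : injective (@oneline n).
Proof.
move=> p q /eq_in_map eq_pq; apply/permP=> i.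
by apply: eq_pq; rewrite mem_enum.
Qed.

Lemma last_topdrop_line (n : nat) (p : 'S_n) :
  last 0 [seq (val v).+1 | v <- topdrop_line p] = top p.
Proof.
rewrite /topdrop_line /top; case: (oneline p) => [|v w] //=.
by rewrite rev_cons map_cat map_rcons last_cat last_rcons.
Qed.

(* Being injective, [topdrop] is a bijection of the finite type ['S_n], so
   [orbit topdrop p] below has the least [s >= 1] with [T^s p = p] as size. *)
Lemma topdrop_inj (n : nat) : injective (@topdrop n).
Proof.
move=> p q /(congr1 (@oneline n)); rewrite !oneline_topdrop => eq_pq.
have eq_top : top p = top q by rewrite -!last_topdrop_line eq_pq.
move: eq_pq; rewrite /topdrop_line eq_top => /eqP.
rewrite eqseq_cat ?size_drop ?size_oneline // => /andP[/eqP eq_d /eqP eq_r].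
apply: oneline_inj; rewrite -(cat_take_drop (top q) (oneline p)) eq_d.
by rewrite (can_inj revK eq_r) cat_take_drop.
Qed.

(** Necklaces are represented by the finite sequences obtained by cutting them
    open; two sequences represent the same necklace when they are rotations of
    each other. *)

Definition same_necklace (s t : seq nat) : bool :=
  [exists k : 'I_(size t).+1, s == rot k t].

Definition topdrop_necklace (n : nat) (p : 'S_n) : seq nat :=
  [seq top q | q <- orbit (@topdrop n) p].

Definition topdrop_valid (n : nat) (N : seq nat) : Prop :=
  exists p : 'S_n, same_necklace (topdrop_necklace p) N.

Definition orbits_with_necklace (n : nat) (N : seq nat) : {set {set 'S_n}} :=
  [set [set q in orbit (@topdrop n) p]
     | p : 'S_n & same_necklace (topdrop_necklace p) N].

Definition has_period (N : seq nat) (t : nat) : bool :=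
  (0 < t) && [forall i : 'I_(size N), nth 0 N ((i + t) %% size N) == nth 0 N i].

Lemma ex_period (N : seq nat) : exists t, has_period N t.
Proof.
exists (size N).-1.+1; apply/andP; split=> //; apply/forallP=> i.
have lt_iN := ltn_ord i.
by rewrite (ltn_predK lt_iN) modnDr modn_small.
Qed.

Definition segment_length (N : seq nat) : nat := ex_minn (ex_period N).

(* The division is exact when [N] is nonempty: the least cyclic period divides
   the size. *)
Definition fundamental_period (N : seq nat) : nat :=
  size N %/ segment_length N.

Definition nb_values (N : seq nat) : nat := size (undup N).

(* Main.v *)
Require Import Defs.
From mathcomp Require Import all_boot fingroup perm ssralg ssrnum rat.
Import GRing.Theory.
Local Open Scope ring_scope.

(** The map [T] moves positions by a rule that only depends on the first entry,
    so right multiplication by a permutation [w] of the values commutes with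
    [T] as long as [w] fixes that entry.  Hence the permutations with the same
    sequence of tops as [p] are exactly the [p * w] with [w] fixing the [d]
    values occurring in the necklace: there are [(n - d)!] of them, and their
    orbits have the same size.  A necklace of size [s] with least period [t] has
    [t] distinct rotations, so it is the necklace of [t (n - d)!] permutations;
    these split into orbits of size [s], which leaves [(n - d)! / (s / t)]
    orbits. *)

(** * Least cyclic period of a sequence and its distinct rotations *)

Lemma nth_rot (T : Type) (x0 : T) (s : seq T) (k i : nat) :
  (k <= size s -> i < size s ->
  nth x0 (rot k s) i = nth x0 s ((k + i) %% size s))%N.
Proof.
move=> le_ks lt_is; rewrite nth_cat size_drop ltn_subRL nth_drop.
case: ltnP => [lt_ki|le_ki]; first by rewrite modn_small.
have lt_iks : (k + i - size s < k)%N.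
  by rewrite ltn_subLR // [X in (_ < X)%N]addnC ltn_add2l.
rewrite subnBA // [(i + k)%N]addnC nth_take // -{2}(subnK le_ki) modnDr.
by rewrite modn_small // (leq_trans lt_iks).
Qed.

Lemma has_periodP (N : seq nat) (t : nat) :
  reflect ((0 < t)%N /\ forall i : nat,
             nth 0%N N ((i + t) %% size N) = nth 0%N N (i %% size N))
          (has_period N t).
Proof.
apply: (iffP andP) => -[t_gt0 perN]; split=> //.
- case: N perN => [|x N] /forallP perN i; first by rewrite !nth_nil.
  have := perN (Ordinal (ltn_pmod i (ltn0Sn (size N)))).
  by rewrite /= modnDml => /eqP.
- by apply/forallP=> i; rewrite perN modn_small.
Qed.

Section SegmentLength.

Variable N : seq nat.
Hypothesis N_gt0 : (0 < size N)%N.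

Let t := segment_length N.

Lemma segment_length_period : has_period N t.
Proof. by rewrite /t /segment_length; case: ex_minnP. Qed.

Lemma segment_length_min (u : nat) : has_period N u -> (t <= u)%N.
Proof. by rewrite /t /segment_length; case: ex_minnP => m _; apply. Qed.

Lemma segment_length_gt0 : (0 < t)%N.
Proof. by have /andP[] := segment_length_period. Qed.

Lemma nth_segment_length (k i : nat) :
  nth 0%N N ((i + k * t) %% size N) = nth 0%N N (i %% size N).
Proof.
have /has_periodP[_ per_t] := segment_length_period.
elim: k => [|k IHk]; first by rewrite mul0n addn0.
by rewrite mulSn addnCA addnC per_t IHk.
Qed.

(** Since both [t] and [size N] shift [N] to itself, so does the remainder of [size N] modulo [t];
    if positive, it would be a period below the minimum. *)
Lemma segment_length_dvd : (t %| size N)%N.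
Proof.
rewrite /dvdn; case: posnP => // r_gt0.
suff /segment_length_min : has_period N (size N %% t).
  by rewrite leqNgt ltn_mod segment_length_gt0.
apply/has_periodP; split=> // i.
rewrite -(nth_segment_length (size N %/ t)) -addnA addnC.
by rewrite [((_ %% t) + _)%N]addnC -divn_eq modnDl.
Qed.

Lemma segment_length_le : (t <= size N)%N.
Proof. exact: dvdn_leq segment_length_dvd. Qed.

Lemma rot_segment_length (k : nat) :
  (k <= size N)%N -> rot k N = rot (k %% t) N.
Proof.
move=> le_kN; apply: (@eq_from_nth _ 0%N) => [|i]; rewrite !size_rot // => lt_iN.
have lt_kt := ltn_pmod k segment_length_gt0.
rewrite !nth_rot // ?(leq_trans (ltnW lt_kt) segment_length_le) //.
by rewrite {1}(divn_eq k t) -addnA addnC nth_segment_length.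
Qed.

(** If the rotations by [a < b] agree, then [b - a] is a period smaller than [t]. *)
Lemma rot_inj_segment_length (a b : nat) :
  (a < t)%N -> (b < t)%N -> rot a N = rot b N -> a = b.
Proof.
wlog le_ab : a b / (a <= b)%N => [IH lt_at lt_bt eq_ab|].
  by case: (leqP a b) => [|/ltnW] /IH -> //.
move=> lt_at lt_bt eq_ab; apply/eqP; rewrite eqn_leq le_ab leqNgt.
apply/negP=> lt_ab.
suff /segment_length_min : has_period N (b - a).
  by rewrite leqNgt (leq_ltn_trans (leq_subr _ _) lt_bt).
apply/has_periodP; split=> [|i]; first by rewrite subn_gt0.
have leN c : (c < t)%N -> (c <= size N)%N.
  by move=> /ltnW/leq_trans -> //; apply: segment_length_le.
(* Chosen so that [a + j] is [i] and [b + j] is [i + (b - a)] modulo [size N]. *)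
pose j := ((i + (size N - a)) %% size N)%N.
have lt_j : (j < size N)%N by rewrite ltn_pmod.
have := congr1 (nth 0%N ^~ j) eq_ab.
rewrite !nth_rot ?(leN _ lt_at) ?(leN _ lt_bt) // !modnDmr.
have -> : (a + (i + (size N - a)) = i + size N)%N.
  by rewrite addnCA subnKC ?leN.
have -> : (b + (i + (size N - a)) = i + (b - a) + size N)%N.
  by rewrite addnCA (addnBA b (leN _ lt_at)) -(addnBAC _ le_ab) addnA.
by rewrite !modnDr.
Qed.

End SegmentLength.

(** * Rotating a necklace and moving along an orbit *)

Lemma same_necklaceP (s t : seq nat) :
  reflect (exists2 k : nat, (k <= size t)%N & s = rot k t) (same_necklace s t).
Proof.
apply: (iffP existsP) => [[k /eqP eq_st]|[k le_kt eq_st]].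
  by exists k; first exact: leq_ord.
by exists (Ordinal (le_kt : (k < (size t).+1)%N)); apply/eqP.
Qed.

Lemma same_necklace_rot (s t : seq nat) (k : nat) :
  same_necklace s t -> same_necklace (rot k s) t.
Proof.
move=> /same_necklaceP[j le_jt ->].
have [le_tk|/ltnW le_kt] := leqP (size t) k.
  by rewrite rot_oversize ?size_rot //; apply/same_necklaceP; exists j.
apply/same_necklaceP; rewrite rot_add_mod //.
case: leqP => [le_kj|_]; first by exists (k + j)%N.
exists (k + j - size t)%N => //.
by rewrite leq_subLR leq_add.
Qed.

Lemma same_necklace_size (s t : seq nat) : same_necklace s t -> size s = size t.
Proof. by move=> /same_necklaceP[k _ ->]; rewrite size_rot. Qed.

Lemma nb_values_rot (k : nat) (N : seq nat) : nb_values (rot k N) = nb_values N.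
Proof. exact/perm_size/perm_undup/mem_rot. Qed.

Lemma size_topdrop_necklace (n : nat) (p : 'S_n) :
  size (topdrop_necklace p) = fingraph.order (@topdrop n) p.
Proof. by rewrite size_map size_orbit. Qed.

Lemma topdrop_necklace_rot (n : nat) (p q : 'S_n) :
  q \in orbit (@topdrop n) p ->
  exists k, topdrop_necklace q = rot k (topdrop_necklace p).
Proof.
have [c_p u_p] := (cycle_orbit (@topdrop_inj n) p, orbit_uniq (@topdrop n) p).
by move=> /(orbitE c_p u_p) eq_o; eexists; rewrite /topdrop_necklace eq_o map_rot.
Qed.

Lemma rot_topdrop_necklace (n : nat) (p : 'S_n) (k : nat) :
  exists q : 'S_n, topdrop_necklace q = rot k (topdrop_necklace p).
Proof.
have [c_p u_p] := (cycle_orbit (@topdrop_inj n) p, orbit_uniq (@topdrop n) p).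
have [le_k|lt_k] := leqP (size (topdrop_necklace p)) k.
  by exists p; rewrite rot_oversize.
rewrite size_map in lt_k.
exists (nth p (orbit (@topdrop n) p) k).
by rewrite /topdrop_necklace (orbitE c_p u_p) ?mem_nth // index_uniq // map_rot.
Qed.

(** Validity gives a permutation whose necklace is only some rotation of [N]; moving along its orbit
    reaches each rotation as an exact list. *)
Lemma topdrop_valid_rot (n : nat) (N : seq nat) (k : nat) :
  topdrop_valid n N -> exists q : 'S_n, topdrop_necklace q = rot k N.
Proof.
move=> [p /same_necklaceP[j _ eq_p]].
(* Rotating by [size N - j] undoes [rot j]. *)
have [q eq_q] := rot_topdrop_necklace _ p (size N - j)%N.
have [r eq_r] := rot_topdrop_necklace _ q k; exists r.
by rewrite eq_r eq_q eq_p -{1}(size_rot j N) -/(rotr j _) rotK.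
Qed.

Lemma top_iter_topdrop (n : nat) (p : 'S_n) (j : nat) :
  top (iter j (@topdrop n) p)
    = nth 0%N (topdrop_necklace p) (j %% size (topdrop_necklace p))%N.
Proof.
rewrite size_topdrop_necklace; set s := fingraph.order _ p.
have lt_js : (j %% s < s)%N by rewrite ltn_mod fingraph.order_gt0.
rewrite (nth_map p) ?size_orbit // nth_traject //; congr top.
rewrite {1}(divn_eq j s) addnC iterD; congr (iter _ _ _).
elim: (j %/ s)%N => [|k IHk] //.
by rewrite mulSn iterD IHk (iter_order (@topdrop_inj n)).
Qed.

(** * Permutations with the same sequence of tops *)

Lemma oneline_mul (n : nat) (p w : 'S_n) :
  oneline (p * w)%g = map w (oneline p).
Proof. by rewrite /oneline -map_comp; apply: eq_map => i; rewrite /= permM. Qed.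

Lemma topE (n : nat) (p : 'S_n.+1) : top p = (p ord0).+1.
Proof. by rewrite /top /oneline /image_mem enum_ordSl. Qed.

Lemma topdrop_mul (n : nat) (p w : 'S_n.+1) :
  w (p ord0) = p ord0 -> topdrop (p * w)%g = (topdrop p * w)%g.
Proof.
move=> fix_w; apply: oneline_inj.
rewrite oneline_mul !oneline_topdrop /topdrop_line oneline_mul.
by rewrite !topE permM fix_w map_cat map_rev map_drop map_take.
Qed.

(** The necklace values shifted down by one, kept as ordinals so that the complement can serve as
    the support of a permutation. *)
Definition orbit_tops {n : nat} (p : 'S_n.+1) : {set 'I_n.+1} :=
  [set q ord0 | q : 'S_n.+1 in orbit (@topdrop n.+1) p].

Lemma nb_values_necklace (n : nat) (p : 'S_n.+1) :
  nb_values (topdrop_necklace p) = #|orbit_tops p|.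
Proof.
rewrite /nb_values /topdrop_necklace (eq_map (@topE n)).
rewrite (map_comp (fun i : 'I_n.+1 => i.+1)) undup_map_inj; last first.
  by move=> i j [/val_inj].
rewrite size_map -(card_uniqP (undup_uniq _)); apply: eq_card => i.
rewrite mem_undup; apply/mapP/imsetP=> -[q]; by exists q.
Qed.

Lemma topdrop_necklace_mul (n : nat) (p w : 'S_n.+1) :
  w \in perm_on (~: orbit_tops p) ->
  topdrop_necklace (p * w)%g = topdrop_necklace p.
Proof.
move=> on_w; set T := @topdrop n.+1.
have fix_w q : q \in orbit T p -> w (q ord0) = q ord0.
  by move=> q_p; rewrite (out_perm on_w) // inE negbK imset_f.
have orbit_pw : orbit T (p * w)%g = [seq (q * w)%g | q <- orbit T p].
  (* The translate by [w] of the orbit of [p] is a cycle of [T]; it has no repetition, so it is the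
     whole orbit of [p * w]. *)
  have cyc : fcycle T [seq (q * w)%g | q <- orbit T p].
    apply: (homo_cycle_in (P := [in orbit T p]) (e := frel T)).
    - by move=> q r q_p _ /= /eqP <-; rewrite /T topdrop_mul ?fix_w.
    - exact/allP.
    - exact: cycle_orbit (@topdrop_inj _) p.
  have := cyc; rewrite {1}/orbit -orderSpred /= => /undup_cycle_cons <-.
  rewrite -[RHS]undup_id; first by rewrite /orbit -orderSpred.
  by rewrite map_inj_uniq ?orbit_uniq //; apply: mulIg.
rewrite /topdrop_necklace orbit_pw -map_comp; apply/eq_in_map => q q_p /=.
by rewrite !topE permM fix_w.
Qed.

(** By induction on [j], the [j]-th iterates differ by [w] on the right; as their tops agree, [w]
    fixes that top, which lets it pass through the next application of [T]. *)
Lemma eq_topdrop_necklace (n : nat) (p q : 'S_n.+1) :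
  topdrop_necklace q = topdrop_necklace p ->
  (p^-1 * q)%g \in perm_on (~: orbit_tops p).
Proof.
move=> eq_pq; set w := (p^-1 * q)%g; set T := @topdrop n.+1.
have eq_top j : top (iter j T q) = top (iter j T p).
  by rewrite !top_iter_topdrop eq_pq.
have iterM j : iter j T q = (iter j T p * w)%g.
  elim: j => [|j IHj]; first by rewrite /w mulKVg.
  have /eqP := eq_top j; rewrite !topE eqSS => /eqP/val_inj.
  rewrite IHj permM => fix_w; rewrite !iterS IHj.
  exact: topdrop_mul.
rewrite unfold_in; apply/subsetP=> x; apply: contraR; rewrite !inE negbK.
move=> /imsetP[r /trajectP[j _ ->] ->]; apply/eqP/val_inj.
by have := eq_top j; rewrite !topE iterM permM => -[].
Qed.

Lemma card_topdrop_necklace_class (n : nat) (p : 'S_n.+1) :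
  #|[set q : 'S_n.+1 | topdrop_necklace q == topdrop_necklace p]|
    = (n.+1 - nb_values (topdrop_necklace p))`!%N.
Proof.
rewrite nb_values_necklace -[X in (X - _)%N](card_ord n.+1).
rewrite -[orbit_tops p]setCK -cardsCs.
rewrite -card_perm -[RHS](card_imset _ (mulgI p)); apply: eq_card => q.
rewrite inE; apply/eqP/imsetP => [/eq_topdrop_necklace on_w|[w on_w ->]].
  by exists (p^-1 * q)%g; rewrite ?mulKVg.
exact: topdrop_necklace_mul.
Qed.

(** * Counting the permutations with a given necklace in two ways *)

Lemma topdrop_valid_size_gt0 (n : nat) (N : seq nat) :
  topdrop_valid n N -> (0 < size N)%N.
Proof.
move=> [p /same_necklace_size <-].
by rewrite size_topdrop_necklace fingraph.order_gt0.
Qed.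

Lemma card_necklace_perms (n : nat) (N : seq nat) :
  topdrop_valid n.+1 N ->
  #|[set q : 'S_n.+1 | same_necklace (topdrop_necklace q) N]|
    = (segment_length N * (n.+1 - nb_values N)`!)%N.
Proof.
move=> validN; have N_gt0 := topdrop_valid_size_gt0 _ _ validN.
set t := segment_length N.
have t_le : (t <= size N)%N by apply: segment_length_le.
(* Permutations are sorted by the rotation of [N] that their necklace equals as a list. *)
transitivity (\sum_(k < t)
    #|[set q : 'S_n.+1 | topdrop_necklace q == rot k N]|)%N; last first.
  rewrite -[t in RHS]card_ord -sum_nat_const; apply: eq_bigr => k _.
  have [q eq_q] := topdrop_valid_rot _ _ k validN.
  by rewrite -eq_q card_topdrop_necklace_class eq_q nb_values_rot.
(* After exchanging the sums, it remains to see that each [q] matches exactly one [k < t], namely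
   [j %% t], or none. *)
under [RHS]eq_bigr => k _ do rewrite -sum1dep_card big_mkcond /=.
rewrite exchange_big -sum1dep_card big_mkcond /=; apply: eq_bigr => q _.
case: same_necklaceP => [[j le_jN eq_q]|no_k].
  have lt_jt : (j %% t < t)%N by rewrite ltn_mod segment_length_gt0.
  rewrite (bigD1 (Ordinal lt_jt)) //= eq_q -rot_segment_length // eqxx big1 //.
  move=> k; apply: contraNeq; case: (rot j N =P rot k N) => // eq_k _.
  apply/eqP/val_inj => /=.
  apply: (rot_inj_segment_length N) => //.
  by rewrite -rot_segment_length // -eq_k.
rewrite big1 // => k _; case: eqP => // eq_q; case: no_k.
by exists k => //; apply: leq_trans (ltnW (ltn_ord k)) t_le.
Qed.

(** [X] is a union of orbits, because the necklace only rotates along an orbit; each of them has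
    [size N] elements. *)
Lemma card_necklace_perms_orbits (n : nat) (N : seq nat) :
  #|[set q : 'S_n | same_necklace (topdrop_necklace q) N]|
    = (#|orbits_with_necklace n N| * size N)%N.
Proof.
pose O (p : 'S_n) := [set q in orbit (@topdrop n) p].
set X := [set q | _].
have -> : orbits_with_necklace n N = O @: X.
  apply/setP=> A; apply/imsetP/imsetP => -[p p_N ->];
    by exists p; rewrite ?inE // in p_N *.
rewrite -sum1_card (partition_big_imset O) -sum_nat_const.
apply: eq_bigr => A /imsetP[p p_N ->]; rewrite inE in p_N.
rewrite sum1dep_card -(same_necklace_size _ _ p_N).
rewrite size_map -(card_uniqP (orbit_uniq _ _)); apply: eq_card => q.
rewrite !inE; apply/andP/idP => [[_ /eqP/setP/(_ q)]|q_p].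
  by rewrite !inE in_orbit.
have [k ->] := topdrop_necklace_rot _ _ _ q_p.
split; first exact: same_necklace_rot.
apply/eqP/setP=> r; rewrite !inE.
by rewrite (orbitE (cycle_orbit (@topdrop_inj n) p)) ?orbit_uniq // mem_rot.
Qed.

Theorem theorem4p1 (n : nat) (N : seq nat)
    (n_gt0 : (1 <= n)%N) (N_valid : topdrop_valid n N) :
  #|orbits_with_necklace n N|%:R
    = ((n - nb_values N)`!)%N%:R / (fundamental_period N)%:R :> rat.
Proof.
have N_gt0 := topdrop_valid_size_gt0 _ _ N_valid.
case: n n_gt0 N_valid => // n _ validN.
have t_gt0 := segment_length_gt0 N.
have size_N : size N = (fundamental_period N * segment_length N)%N.
  by rewrite divnK ?segment_length_dvd.
have P_gt0 : (0 < fundamental_period N)%N.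
  by move: N_gt0; rewrite size_N muln_gt0 => /andP[].
have P_neq0 : (fundamental_period N)%:R != 0 :> rat.
  by rewrite Num.Theory.pnatr_eq0 -lt0n.
(* With the denominator cleared, multiplying by the least period [t] turns both sides into counts of
   the same permutations. *)
apply: (canRL (mulfK P_neq0)); rewrite -natrM; congr _%:R; apply/eqP.
rewrite -(eqn_pmul2r t_gt0) -mulnA -size_N -card_necklace_perms_orbits.
by rewrite card_necklace_perms // mulnC.
Qed.
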